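(* Let $\mathcal{F}=\{e_j\}_{j=1}^N$ be a unit-norm tight frame of $\mathbb{R}^d$ with $F=[e_1,\dots,e_N]$, and let $\delta>0$. Model the quantization errors as in the White Noise Hypothesis: let $\eta_1,\dots,\eta_N$ be independent random variables, each uniformly distributed on $[-\delta/2,\delta/2)$, and let the reconstruction error be the random vector $\mathrm{Err}:=\frac dN\sum_{j=1}^N\eta_je_j$. Then for every $\varepsilon\in(0,1/2)$, $$\Pr\Bigl(\|\mathrm{Err}\|\le \frac{d\,\delta}{N^{1/2-\varepsilon}}\bigl(\sigma(F)+1\bigr)\Bigr)\ge 1-2N\exp(-2N^{2\varepsilon}).$$
   Context: A finite family $\{e_j\}_{j=1}^N\subset\mathbb{R}^d$ is a unit-norm tight frame if $\|e_j\|=1$ and $\sum_j e_je_j^T=\frac Nd I_d$. The variation of $F=[e_1,\dots,e_N]$ is $\sigma(F):=\min_{p}\sum_{j=1}^{N-1}\|e_{p(j)}-e_{p(j+1)}\|$, the minimum over all permutations $p$ of $\{1,\dots,N\}$. *)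

(* Defs.v *)
From HB Require Import structures.
From mathcomp Require Import all_boot all_order all_algebra all_fingroup.
From mathcomp Require Import all_classical all_reals all_analysis.
Set Implicit Arguments. Unset Strict Implicit. Unset Printing Implicit Defensive.
Import Order.TTheory GRing.Theory Num.Theory.
Local Open Scope ring_scope.
Local Open Scope classical_set_scope.

Definition enorm (R : realType) (d : nat) (v : 'rV[R]_d) : R :=
  Num.sqrt (\sum_(i < d) v 0 i ^+ 2).

(* Unit-norm tight frame {e_j}_{j<N} of R^d:
   ||e_j|| = 1 and sum_j e_j e_j^T = (N/d) I_d
   (with row vectors, e_j e_j^T is (e j)^T *m (e j)). *)
Definition unit_norm_tight_frame (R : realType) (d N : nat)
    (e : 'I_N -> 'rV[R]_d) : Prop :=
  (forall j, enorm (e j) = 1) /\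
  \sum_(j < N) ((e j)^T *m e j) = (N%:R / d%:R) *: (1%:M : 'M[R]_d).

(* Path length sum_{j=1}^{N-1} ||e_{p(j)} - e_{p(j+1)}|| for a permutation p
   (0-based: j ranges over 0..N-2, successor j+1). *)
Definition path_length (R : realType) (d N : nat) (e : 'I_N -> 'rV[R]_d)
    (p : {perm 'I_N}) : R :=
  \sum_(j : 'I_N | (j.+1 < N)%N) enorm (e (p j) - e (p (eqtype.insubd j j.+1))).

(* Variation sigma(F): minimum of path_length over all permutations
   (the seed value is the identity permutation's length, which is itself
   one of the terms, so this is exactly the minimum). *)
Definition frame_variation (R : realType) (d N : nat) (e : 'I_N -> 'rV[R]_d) : R :=
  \big[Order.min/path_length e 1]_(p : {perm 'I_N}) path_length e p.

Definition mutually_independent (R : realType) (dT : measure_display)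
    (T : measurableType dT) (P : probability T R) (N : nat)
    (X : 'I_N -> {RV P >-> R}) : Prop :=
  forall (S : {set 'I_N}) (B : 'I_N -> set R),
    (forall j, measurable (B j)) ->
    P (\big[setI/setT]_(j in S) (X j @^-1` B j)) =
    (\prod_(j in S) P (X j @^-1` B j))%E.

Definition uniform_on_Ico (R : realType) (dT : measure_display)
    (T : measurableType dT) (P : probability T R) (X : {RV P >-> R})
    (a b : R) : Prop :=
  forall B : set R, measurable B ->
    P (X @^-1` B) =
    (((b - a)^-1)%:E * (@lebesgue_measure R) (B `&` `[a, b[))%E.

(* Main.v *)
(** Order the frame along a permutation p realising sigma(F) and let S_k be the
    sum of the first k errors in that order.  Summation by parts gives
      sum_i eta_p(i) e_p(i) = S_N e_p(N) + sum_(i<N) S_i (e_p(i) - e_p(i+1)),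
    hence |Err| <= (d/N) (max_k |S_k|) (sigma(F) + 1).  Hoeffding's inequality
    at t = delta N^(1/2+eps) gives P(|S_k| >= t) <= 2 exp(-2 N^(2 eps)) because
    S_k has at most N terms, and a union bound over k concludes.  For a uniform
    error on [-c, c) the exponential moment is sinh(sc)/(sc), which is at most
    cosh(sc) <= exp((sc)^2/2). *)

Require Import Defs.
From HB Require Import structures.
From mathcomp Require Import all_boot all_order all_algebra all_fingroup.
From mathcomp Require Import all_classical all_reals all_analysis.
From mathcomp Require Import measurable_realfun ring lra.
Import Order.TTheory GRing.Theory Num.Theory.
Import numFieldNormedType.Exports.
Local Open Scope ring_scope.
Local Open Scope classical_set_scope.

(** * Transfer of integrals and product expectations *)

Section weighted_preimage.

Import HBNNSimple.

(** The hypothesis on [B] is the conclusion for indicators; linearity extends it to simple functions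
    and monotone convergence to nonnegative measurable [f]. It serves twice: with [G] a product of
    the remaining factors and [nu] a law, to split off one independent factor; and with [G] a
    density and [X] the identity, to integrate against a law. *)
Lemma ge0_integral_weighted_preimage (R : realType) (dT : measure_display)
    (T : measurableType dT) (mu : {measure set T -> \bar R})
    (nu : {measure set R -> \bar R}) (G X : T -> R) (C : \bar R) :
  measurable_fun setT G -> (forall x, 0 <= G x) ->
  measurable_fun setT X -> C \is a fin_num ->
  (forall B, measurable B ->
    (\int[mu]_x (G x * \1_B (X x))%:E = C * nu B)%E) ->
  forall f : R -> R, measurable_fun setT f -> (forall y, 0 <= f y) ->
  (\int[mu]_x (G x * f (X x))%:E = C * \int[nu]_y (f y)%:E)%E.
Proof.
move=> mG G0 mX Cfin GX f mf f0.
have mEf : measurable_fun setT (fun y : R => (f y)%:E) by exact/measurable_EFinP.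
have Ef0 (y : R) : setT y -> (0 <= (f y)%:E)%E by rewrite lee_fin.
pose h := nnsfun_approx measurableT mEf.
have mhX n : measurable_fun setT (fun x => h n (X x)).
  exact: measurableT_comp.
have nd_h y a b : (a <= b)%N -> h a y <= h b y.
  by move=> ab; exact/lefP/nd_nnsfun_approx.
have simple (g : {nnsfun R >-> R}) :
    (\int[mu]_x (G x * g (X x))%:E = C * \int[nu]_y (g y)%:E)%E.
  have mpre r : measurable (g @^-1` [set r]) by [].
  have m1 r : measurable_fun setT (fun x => \1_(g @^-1` [set r]) (X x) : R).
    exact: measurableT_comp.
  have y0 r (rg : range g r) : 0 <= r by case: rg => x _ <-.
  (* [ge0_integral_fsum] wants nonnegative terms for every r, not only for r in
     the range of g: hence [`|r|]. *)
  transitivity (\int[mu]_x \sum_(r \in range g)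
      (`|r|%:E * (G x * \1_(g @^-1` [set r]) (X x))%:E))%E.
    apply: eq_integral => x _.
    rewrite {1}fimfunE mulr_fsumr // -fsumEFin //.
    apply: eq_fsbigr => r /set_mem rg; rewrite ger0_norm ?y0// -EFinM.
    by congr _%:E; rewrite mulrCA.
  rewrite ge0_integral_fsum//; last 2 first.
  - by move=> r; apply/measurable_EFinP; do 2 apply: measurable_funM => //.
  - by move=> r x _; rewrite -EFinM lee_fin !mulr_ge0.
  rewrite (_ : \int[nu]_y (g y)%:E = \int[nu]_y \sum_(r \in range g)
      (`|r|%:E * (\1_(g @^-1` [set r]) y)%:E))%E; last first.
    apply: eq_integral => x _.
    rewrite {1}fimfunE -fsumEFin //.
    apply: eq_fsbigr => r /set_mem rg; rewrite ger0_norm ?y0//.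
  rewrite ge0_integral_fsum//; last first.
    by move=> r; apply/measurable_EFinP; apply: measurable_funM.
  rewrite ge0_mule_fsumr; last first.
    by move=> r; apply: integral_ge0 => x _; rewrite -EFinM lee_fin mulr_ge0.
  apply: eq_fsbigr => r _.
  rewrite ge0_integralZl//; last 2 first.
  - by apply/measurable_EFinP; apply: measurable_funM.
  - by move=> x _; rewrite lee_fin mulr_ge0.
  rewrite ge0_integralZl//; last exact/measurable_EFinP.
  by rewrite GX// integral_indic// setIT muleCA.
transitivity (limn (fun n => \int[mu]_x (G x * h n (X x))%:E))%E.
  rewrite -monotone_convergence//.
  - apply: eq_integral => x _; apply/esym/cvg_lim => //.
    rewrite EFinM; under eq_fun do rewrite EFinM.
    by apply: cvgeZl => //; exact: cvg_nnsfun_approx.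
  - by move=> n; apply/measurable_EFinP; apply: measurable_funM.
  - by move=> n x _; rewrite lee_fin mulr_ge0.
  - by move=> x _ a b ab; rewrite lee_fin ler_wpM2l ?nd_h.
have nd_int : nondecreasing_seq (fun n => \int[nu]_y (h n y)%:E)%E.
  move=> a b ab; apply: ge0_le_integral => //.
  - by move=> y _; rewrite lee_fin.
  - exact/measurable_EFinP.
  - exact/measurable_EFinP.
  - by move=> y _; rewrite lee_fin nd_h.
under eq_fun do rewrite simple.
rewrite (_ : \int[nu]_y (f y)%:E = limn (fun n => \int[nu]_y (h n y)%:E))%E.
  (* Finiteness of [C] lets it leave the limit. *)
  rewrite limeMl//; last exact: ereal_nondecreasing_is_cvgn.
rewrite -monotone_convergence//.
- apply: eq_integral => y _; apply/esym/cvg_lim => //.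
  exact: (cvg_nnsfun_approx measurableT mEf Ef0).
- by move=> n; exact/measurable_EFinP.
- by move=> n y _; rewrite lee_fin.
- by move=> y _ a b ab; rewrite lee_fin nd_h.
Qed.

End weighted_preimage.

Lemma prodr_indic (R : realType) (T : Type) (I : finType) (A : I -> set T)
    (w : T) :
  \prod_i \1_(A i) w = \1_(\big[setI/setT]_i A i) w :> R.
Proof.
elim/big_rec2: _ => [|i x B _ ->]; first by rewrite indicT.
by rewrite indicI.
Qed.

(** Factorises the exponential moment of a sum. Finite expectations make the product of all but one
    of them an admissible constant [C] in the transfer lemma. *)
Lemma expectation_prod_independent (R : realType) (dT : measure_display)
    (T : measurableType dT) (P : probability T R) (N : nat)
    (X : 'I_N -> {RV P >-> R}) (f : 'I_N -> R -> R) :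
  mutually_independent X ->
  (forall j, measurable_fun setT (f j)) -> (forall j y, 0 <= f j y) ->
  (forall j, (\int[P]_w (f j (X j w))%:E < +oo)%E) ->
  (\int[P]_w (\prod_j f j (X j w))%:E = \prod_j \int[P]_w (f j (X j w))%:E)%E.
Proof.
move=> indX.
(* Replace the functions by indicators from index [n] on; for indicators the
   claim is independence itself. *)
suff main n (g : 'I_N -> R -> R) : (forall j, measurable_fun setT (g j)) ->
    (forall j y, 0 <= g j y) ->
    (forall j, (\int[P]_w (g j (X j w))%:E < +oo)%E) ->
    (forall j : 'I_N, (n <= j)%N ->
      exists2 B : set R, measurable B & g j = \1_B) ->
    (\int[P]_w (\prod_j g j (X j w))%:E =
     \prod_j \int[P]_w (g j (X j w))%:E)%E.
  move=> mf f0 foo; apply: (main N) => // j.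
  by rewrite leqNgt ltn_ord.
elim: n g => [|n IH] g mg g0 goo gind.
  have /choice[B HB] j : exists B : set R, measurable B /\ g j = \1_B.
    by have [B mB gB] := gind j (leq0n j); exists B.
  have mB j : measurable (B j) by case: (HB j).
  have gB j : g j = \1_(B j) by case: (HB j).
  have mXB j : measurable (X j @^-1` B j) by exact: measurable_funPTI.
  transitivity (\int[P]_w (\1_(\big[setI/setT]_j (X j @^-1` B j)) w)%:E)%E.
    apply: eq_integral => w _; rewrite -prodr_indic; congr _%:E.
    by apply: eq_bigr => j _; rewrite gB.
  rewrite integral_indic ?setIT//; last exact: bigsetI_measurable.
  have := indX [set: 'I_N]%SET B mB.
  rewrite (eq_bigl xpredT) => [|j]; last by rewrite finset.in_setT.
  rewrite [in RHS](eq_bigl xpredT) => [|j]; last by rewrite finset.in_setT.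
  move=> indB; transitivity (\prod_j P (X j @^-1` B j))%E; first exact: indB.
  apply: eq_bigr => j _.
  transitivity (\int[P]_w (\1_(X j @^-1` B j) w)%:E)%E.
    by rewrite integral_indic// setIT.
  by apply: eq_integral => w _; rewrite gB.
(* If N <= n, no index reaches n, so the induction hypothesis applies as it stands. Otherwise only
   the factor of index n has to be reduced to indicators. *)
have [Nn|nN] := leqP N n.
  by apply: IH => // j; rewrite leqNgt (leq_trans (ltn_ord j) Nn).
pose k := Ordinal nN.
have mX j : measurable_fun setT (fun w => g j (X j w)) by exact: measurableT_comp.
pose G w := \prod_(j | j != k) g j (X j w).
rewrite (bigD1 k)//= muleC.
transitivity (\int[P]_w (G w * g k (X k w))%:E)%E.
  by apply: eq_integral => w _; rewrite (bigD1 k)//= mulrC.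
rewrite (ge0_integral_weighted_preimage _ _ _ _ (distribution P (X k)) G (X k)
  (\prod_(j | j != k) \int[P]_w (g j (X j w))%:E)%E) //.
- rewrite ge0_integral_distribution//; first exact/measurable_EFinP.
  by move=> y; rewrite lee_fin.
- rewrite /G; under eq_fun do rewrite big_mkcond.
  by apply: measurable_prod => j _; case: (j != k).
- by move=> w; rewrite prodr_ge0.
- apply: prode_fin_num => j _; rewrite ge0_fin_numE ?goo//.
  by apply: integral_ge0 => w _; rewrite lee_fin.
- move=> B mB.
  (* With an indicator at [k], all factors from index n on are indicators, so the induction
     hypothesis covers [g']. *)
  pose g' j := if j == k then \1_B else g j.
  have g'g j : j != k -> g' j = g j by rewrite /g' => /negbTE ->.
  transitivity (\int[P]_w (\prod_j g' j (X j w))%:E)%E.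
    apply: eq_integral => w _; rewrite [in RHS](bigD1 k)//= mulrC {1}/g' eqxx.
    by congr (_ * _)%:E; apply: eq_bigr => j jk; rewrite g'g.
  rewrite IH.
  + rewrite (bigD1 k)//= muleC {2}/g' eqxx integral_indic// ?setIT.
      by congr (_ * _)%E; apply: eq_bigr => j jk; rewrite g'g.
    exact: measurable_funPTI.
  + by move=> j; rewrite /g'; case: ifP.
  + by move=> j y; rewrite /g'; case: ifP.
  + move=> j; rewrite /g'; case: ifP => // _.
    rewrite integral_indic// ?setIT; last exact: measurable_funPTI.
    by rewrite (le_lt_trans (probability_le1 _ _)) ?ltry//; exact: measurable_funPTI.
  + move=> j; rewrite leq_eqVlt => /predU1P[nj|nj].
      by exists B => //; rewrite /g' (_ : j == k)// -val_eqE /= nj.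
    by rewrite g'g; [exact: gind | rewrite -val_eqE /= gtn_eqF].
Qed.

(** * Exponential moment of a uniform variable *)

(** The difference of the two sides vanishes at 0 and has derivative x (e^x - e^(-x)), which is
    nonnegative for x >= 0. *)
Lemma sinh_le_mul_cosh (R : realType) (u : R) : 0 <= u ->
  expR u - expR (- u) <= u * (expR u + expR (- u)).
Proof.
move=> u0.
pose k (x : R) := x * (expR x + expR (- x)) - (expR x - expR (- x)).
have dk (x : R) : is_derive x 1 k (x * (expR x - expR (- x))).
  rewrite /k; apply: is_derive_eq.
  rewrite /GRing.scale /=. ring.
have : k 0 <= k u.
  have dk' x : derivable k x 1 by case: (dk x).
  have ck : continuous (k : R -> R).
    by move=> x; apply/differentiable_continuous/derivable1_diffP.
  apply: (@ger0_derive1_le_cc _ k 0 u) => //.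
  - move=> x; rewrite in_itv /= => /andP[x0 _]; rewrite derive1E.
    rewrite (@derive_val _ _ _ _ _ _ _ (dk x)).
    by rewrite mulr_ge0 ?(ltW x0)// subr_ge0 ler_expR; lra.
  - exact: continuous_subspaceT.
  - by rewrite in_itv /= lexx.
  - by rewrite in_itv /= lexx u0.
by rewrite /k mul0r sub0r oppr0 subrr oppr0 subr_ge0.
Qed.

(** The function 2 cosh(x) exp(-x^2/2) equals 2 at 0 and is nonincreasing for x >= 0: the sign of
    its derivative is that of sinh x - x cosh x. *)
Lemma cosh_le_expR_sqr (R : realType) (u : R) : 0 <= u ->
  expR u + expR (- u) <= 2 * expR (u ^+ 2 / 2).
Proof.
move=> u0.
pose k (x : R) := (expR x + expR (- x)) * expR (- (x ^+ 2 / 2)).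
have dk (x : R) : is_derive x 1 k
    ((expR x - expR (- x) - x * (expR x + expR (- x))) * expR (- (x ^+ 2 / 2))).
  rewrite /k; apply: is_derive_eq.
  rewrite /GRing.scale /=. by field.
have : k u <= k 0.
  have dk' x : derivable k x 1 by case: (dk x).
  have ck : continuous (k : R -> R).
    by move=> x; apply/differentiable_continuous/derivable1_diffP.
  apply: (@ler0_derive1_le_cc _ k 0 u) => //.
  - move=> x; rewrite in_itv /= => /andP[x0 _]; rewrite derive1E.
    rewrite (@derive_val _ _ _ _ _ _ _ (dk x)).
    rewrite mulr_le0_ge0 ?expR_ge0// subr_le0.
    by apply: sinh_le_mul_cosh; exact: ltW.
  - exact: continuous_subspaceT.
  - by rewrite in_itv /= lexx u0.
  - by rewrite in_itv /= lexx.
rewrite /k expr0n /= mul0r !oppr0 expR0 mulr1 (expRN (_ / _)).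
by rewrite ler_pdivrMr ?expR_gt0.
Qed.

Lemma integral_expR_itv (R : realType) (s c : R) : s != 0 -> 0 < c ->
  (\int[lebesgue_measure]_(x in `[(- c)%R, c]) (expR (s * x))%:E =
   ((expR (s * c) - expR (- (s * c))) / s)%:E)%E.
Proof.
move=> s0 c0.
pose F x := expR (s * x) / s.
have dF (x : R) : is_derive x 1 F (expR (s * x)).
  rewrite /F; apply: is_derive_eq.
  by rewrite /GRing.scale /=; field.
have dF' x : derivable F x 1 by case: (dF x).
have cF : continuous (F : R -> R).
  by move=> x; apply/differentiable_continuous/derivable1_diffP.
have cf : continuous (fun x : R => expR (s * x)).
  move=> x; apply: continuous_comp; last exact: continuous_expR.
  exact: mulrl_continuous.
rewrite (@continuous_FTC2 R (fun x => expR (s * x)) F (- c) c)//.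
- by rewrite /F -EFinB mulrN mulrBl.
- by lra.
- exact: continuous_subspaceT.
- split => [x _||]; first exact: dF'.
  + exact/cvg_at_right_filter/cF.
  + exact/cvg_at_left_filter/cF.
- by move=> x _; rewrite derive1E (@derive_val _ _ _ _ _ _ _ (dF x)).
Qed.

(** Both sides are even in [u], which reduces to u > 0, where the two previous inequalities
    chain. *)
Lemma sinh_div_le_expR_sqr (R : realType) (u : R) : u != 0 ->
  (expR u - expR (- u)) / (2 * u) <= expR (u ^+ 2 / 2).
Proof.
wlog u0 : u / 0 < u => [wlogu|u0'].
  rewrite neq_lt => /orP[u0|u0]; last by apply: wlogu => //; rewrite gt_eqF.
  rewrite -(sqrrN u) -[leLHS](_ : (expR (- u) - expR (- - u)) / (2 * - u) = _).
    by apply: wlogu; [rewrite oppr_gt0 | rewrite gt_eqF ?oppr_gt0].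
  by rewrite opprK mulrN invrN mulrN -mulNr opprB.
rewrite ler_pdivrMr ?mulr_gt0//.
have := sinh_le_mul_cosh R u (ltW u0).
have := cosh_le_expR_sqr R u (ltW u0).
nra.
Qed.

Lemma uniform_mgf_le (R : realType) (dT : measure_display)
    (T : measurableType dT) (P : probability T R) (X : {RV P >-> R})
    (c s : R) : 0 < c -> uniform_on_Ico X (- c) c ->
  (\int[P]_w (expR (s * X w))%:E <= (expR ((s * c) ^+ 2 / 2))%:E)%E.
Proof.
move=> c0 unifX.
(* The closed form divides by [s]; at s = 0 both sides are 1. *)
have [->|s0] := eqVneq s 0.
  under eq_integral do rewrite mul0r expR0.
  rewrite integral_cst// [X in (1 * X)%E](probability_setT P) mule1.
  by rewrite mul0r expr0n /= mul0r expR0.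
have mexp : measurable_fun setT (fun x : R => expR (s * x)).
  apply: measurableT_comp => //; exact: measurable_funM.
have cc : 0 <= (c - - c)^-1 by rewrite invr_ge0; lra.
(* Uniformity gives the law on Borel sets only; the transfer lemma turns this into a density formula
   for the exponential. *)
have density : (\int[lebesgue_measure]_x
     (((c - - c)^-1 * \1_(`[- c, c[%classic) x) * expR (s * x))%:E =
    1 * \int[distribution P X]_y (expR (s * y))%:E)%E.
  apply: (ge0_integral_weighted_preimage R _ _ lebesgue_measure
    (distribution P X) (fun x => (c - - c)^-1 * \1_(`[- c, c[%classic) x) id 1%E
    _ _ _ _ _ (fun x => expR (s * x))) => //.
  - exact: measurable_funM.
  - by move=> x; rewrite mulr_ge0.
  - move=> B mB; rewrite mul1e.
    transitivity (\int[lebesgue_measure]_x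
        ((c - - c)^-1%:E * (\1_(B `&` `[- c, c[%classic) x)%:E))%E.
      apply: eq_integral => x _; rewrite -EFinM indicI /= mulrAC -mulrA.
      by congr (_%:E).
    rewrite ge0_integralZl//.
    + rewrite integral_indic//; last exact: measurableI.
      rewrite setIT; exact/esym/unifX.
    + apply/measurable_EFinP; apply: measurable_indic; exact: measurableI.
move: density; rewrite mul1e ge0_integral_distribution//; last exact/measurable_EFinP.
move=> <-.
rewrite (_ : (\int[lebesgue_measure]_x _)%E =
  (((c - - c)^-1)%:E *
    \int[lebesgue_measure]_(x in `[(- c)%R, c[) (expR (s * x))%:E)%E); last first.
  rewrite [in RHS]integral_mkcond -ge0_integralZl//.
  - apply: eq_integral => x _; rewrite patchE indicE.
    case: ifPn => xI; last by rewrite mulr0 mul0r mule0.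
    by rewrite mulr1 EFinM.
  - apply/(measurable_restrictT _ _).1 => //.
    exact/measurable_EFinP/measurable_funTS.
  - by move=> x _; apply: erestrict_ge0 => y _; rewrite lee_fin expR_ge0.
(* The right endpoint is Lebesgue-null, and the closed interval suits the antiderivative. *)
rewrite integral_itv_bndo_bndc; last first.
  exact/measurable_EFinP/measurable_funTS.
rewrite integral_expR_itv// -EFinM lee_fin.
have := sinh_div_le_expR_sqr R (s * c) (mulf_neq0 s0 (lt0r_neq0 c0)).
congr (_ <= _); field.
by rewrite s0 opprK !gt_eqF ?addr_gt0.
Qed.

(** * Hoeffding's inequality for weighted sums *)

Lemma weighted_sum_mgf_le (R : realType) (dT : measure_display)
    (T : measurableType dT) (P : probability T R) (N : nat)
    (X : 'I_N -> {RV P >-> R}) (c r : R) (a : 'I_N -> R) :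
  0 < c -> mutually_independent X ->
  (forall j, uniform_on_Ico (X j) (- c) c) ->
  (\int[P]_w (expR (r * \sum_j a j * X j w))%:E <=
   (expR ((r * c) ^+ 2 / 2 * \sum_j a j ^+ 2))%:E)%E.
Proof.
move=> c0 indX unifX.
have mgf j := uniform_mgf_le R _ _ P (X j) c (r * a j) c0 (unifX j).
rewrite (_ : (\int[P]_w _)%E =
    (\int[P]_w (\prod_j expR (r * a j * X j w))%:E)%E); last first.
  apply: eq_integral => w _; rewrite -expR_sum mulr_sumr; congr (expR _)%:E.
  by apply: eq_bigr => j _; rewrite mulrA.
rewrite (expectation_prod_independent _ _ _ _ _ X (fun j x => expR (r * a j * x)))//.
- rewrite mulr_sumr expR_sum -prodEFin.
  (* The lower bound 0 is carried along because multiplying inequalities requires nonnegative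
     factors. *)
  suff /andP[] : (0 <= \prod_j \int[P]_w (expR (r * a j * X j w))%:E <=
      \prod_j (expR ((r * c) ^+ 2 / 2 * a j ^+ 2))%:E)%E by [].
  apply: (big_ind2 (fun x y : \bar R => 0 <= x <= y)%E) => [|x x' y y'|j _].
  + by rewrite lee01 lexx.
  + by move=> /andP[x0 xx'] /andP[y0 yy']; rewrite mule_ge0//= lee_pmul.
  + rewrite integral_ge0/=; last by move=> w _; rewrite lee_fin expR_ge0.
    apply: (le_trans (mgf j)).
    rewrite lee_fin ler_expR le_eqVlt; apply/orP; left.
    by apply/eqP; field.
- move=> j; apply: measurableT_comp => //; exact: measurable_funM.
- by move=> j; rewrite (le_lt_trans (mgf j)) ?ltry.
Qed.

(** Chernoff's bound with the preceding moment estimate. A mere upper bound [V] on the sum of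
    squares allows one estimate for all partial sums. *)
Lemma hoeffding_weighted_sum (R : realType) (dT : measure_display)
    (T : measurableType dT) (P : probability T R) (N : nat)
    (X : 'I_N -> {RV P >-> R}) (c t V : R) (a : 'I_N -> R) :
  0 < c -> mutually_independent X ->
  (forall j, uniform_on_Ico (X j) (- c) c) ->
  0 < t -> 0 < V -> \sum_j a j ^+ 2 <= V ->
  (P [set w | t <= \sum_j a j * X j w]%R <=
   (expR (- (t ^+ 2 / (2 * c ^+ 2 * V))))%:E)%E.
Proof.
move=> c0 indX unifX t0 V0 aV.
have mZ : measurable_fun setT (fun w => \sum_j a j * X j w).
  by apply: measurable_sum => j; exact: measurable_funM.
pose Z : {RV P >-> R} := mfun_Sub (mem_set mZ).
(* This [r] minimises r^2 c^2 V / 2 - r t, with minimum -t^2 / (2 c^2 V). *)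
pose r := t / (c ^+ 2 * V).
have r0 : 0 < r by rewrite divr_gt0// mulr_gt0// exprn_gt0.
apply: (le_trans (chernoff Z t r0)).
have mgf : ('M_P Z r <= (expR ((r * c) ^+ 2 / 2 * V))%:E)%E.
  rewrite /mmt_gen_fun unlock /=.
  rewrite (_ : (\int[P]_w _)%E =
      (\int[P]_w (expR (r * \sum_j a j * X j w))%:E)%E); last first.
    by apply: eq_integral => w _ /=; rewrite mulrC.
  apply: le_trans (weighted_sum_mgf_le _ _ _ _ _ X c r a c0 indX unifX) _.
  by rewrite lee_fin ler_expR ler_wpM2l// divr_ge0// sqr_ge0.
apply: le_trans (lee_wpmul2r _ mgf) _; first by rewrite lee_fin expR_ge0.
rewrite -EFinM -expRD lee_fin ler_expR le_eqVlt; apply/orP; left.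
by apply/eqP; rewrite /r; field; rewrite !gt_eqF.
Qed.

(** The one-sided bound for the weights [a] and [- a], which have the same squares. *)
Lemma hoeffding_weighted_sum_norm (R : realType) (dT : measure_display)
    (T : measurableType dT) (P : probability T R) (N : nat)
    (X : 'I_N -> {RV P >-> R}) (c t V : R) (a : 'I_N -> R) :
  0 < c -> mutually_independent X ->
  (forall j, uniform_on_Ico (X j) (- c) c) ->
  0 < t -> 0 < V -> \sum_j a j ^+ 2 <= V ->
  (P [set w | t <= `|\sum_j a j * X j w|]%R <=
   (2 * expR (- (t ^+ 2 / (2 * c ^+ 2 * V))))%:E)%E.
Proof.
move=> c0 indX unifX t0 V0 aV.
have mset (b : 'I_N -> R) : measurable [set w | t <= \sum_j b j * X j w].
  have mZ : measurable_fun setT (fun w => \sum_j b j * X j w).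
    by apply: measurable_sum => j; exact: measurable_funM.
  rewrite (_ : [set w | _] = (fun w => \sum_j b j * X j w) @^-1` `[t, +oo[).
    by rewrite -[_ @^-1` _]setTI; exact: mZ.
  by apply/seteqP; split => w /=; rewrite in_itv /= andbT.
have Na : \sum_j (- a j) ^+ 2 <= V by under eq_bigr do rewrite sqrrN.
rewrite (_ : [set w | _] = [set w | t <= \sum_j a j * X j w] `|`
                           [set w | t <= \sum_j - a j * X j w]); last first.
  have sumN w : \sum_j - a j * X j w = - \sum_j a j * X j w.
    by rewrite -sumrN; apply: eq_bigr => j _; rewrite mulNr.
  apply/seteqP; split => w /=; rewrite sumN ler_normr; first by move/orP.
  by move/orP.
apply: le_trans (measureU2 _ (mset _) (mset _)) _.
rewrite mulr2n mulrDl mul1r EFinD; apply: leeD.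
  exact: hoeffding_weighted_sum.
exact: hoeffding_weighted_sum.
Qed.

(** * Euclidean norm *)

Lemma enorm_ge0 (R : realType) (d : nat) (v : 'rV[R]_d) : 0 <= enorm v.
Proof. exact: sqrtr_ge0. Qed.

Lemma sqr_enorm (R : realType) (d : nat) (v : 'rV[R]_d) :
  enorm v ^+ 2 = \sum_(i < d) v 0 i ^+ 2.
Proof. by rewrite sqr_sqrtr // sumr_ge0 // => i _; rewrite sqr_ge0. Qed.

Lemma enormZ (R : realType) (d : nat) (a : R) (v : 'rV[R]_d) :
  enorm (a *: v) = `|a| * enorm v.
Proof.
rewrite /enorm -sqrtr_sqr -sqrtrM ?sqr_ge0// mulr_sumr; congr Num.sqrt.
by apply: eq_bigr => i _; rewrite mxE exprMn.
Qed.

Lemma enorm0 (R : realType) (d : nat) : enorm (0 : 'rV[R]_d) = 0.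
Proof. by rewrite -(scale0r 0) enormZ normr0 mul0r. Qed.

(** The nonnegative sum of the (|v| u_i - |u| v_i)^2 equals 2 |u| |v| (|u| |v| - <u,v>). If |u| |v|
    = 0, one vector is zero and every product vanishes. *)
Lemma enorm_cauchy_schwarz (R : realType) (d : nat) (u v : 'rV[R]_d) :
  \sum_(i < d) u 0 i * v 0 i <= enorm u * enorm v.
Proof.
have [u0|u0] := eqVneq (enorm u * enorm v) 0.
  rewrite u0 big1 // => i _.
  move/eqP: u0; rewrite mulf_eq0.
  have vanish (w : 'rV[R]_d) : enorm w == 0 -> w 0 i = 0.
    move=> /eqP w0; apply/eqP; rewrite -sqrf_eq0.
    have := sqr_enorm R d w; rewrite w0 expr0n => /esym /eqP.
    rewrite psumr_eq0 => [/allP /(_ i)|j _]; last by rewrite sqr_ge0.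
    by rewrite mem_index_enum => /(_ isT).
  by case/orP => /vanish ->; rewrite ?mul0r ?mulr0.
have pos : 0 < enorm u * enorm v by rewrite lt0r u0 mulr_ge0 ?enorm_ge0.
have : 0 <= \sum_(i < d) (enorm v * u 0 i - enorm u * v 0 i) ^+ 2.
  by apply: sumr_ge0 => i _; rewrite sqr_ge0.
rewrite (_ : \sum_(i < d) _ = enorm v ^+ 2 * (\sum_(i < d) u 0 i ^+ 2)
   - 2 * (enorm u * enorm v) * (\sum_(i < d) u 0 i * v 0 i)
   + enorm u ^+ 2 * (\sum_(i < d) v 0 i ^+ 2)); last first.
  rewrite !mulr_sumr -sumrB -big_split /=; apply: eq_bigr => i _; ring.
rewrite -!sqr_enorm => h; rewrite -(ler_pM2l pos); nra.
Qed.

Lemma enormD (R : realType) (d : nat) (u v : 'rV[R]_d) :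
  enorm (u + v) <= enorm u + enorm v.
Proof.
rewrite -ler_sqr ?nnegrE ?addr_ge0 ?enorm_ge0// sqr_enorm.
rewrite (_ : \sum_(i < d) _ = \sum_(i < d) u 0 i ^+ 2 +
  2 * (\sum_(i < d) u 0 i * v 0 i) + \sum_(i < d) v 0 i ^+ 2); last first.
  rewrite mulr_sumr -!big_split /=; apply: eq_bigr => i _; rewrite mxE; ring.
rewrite -!sqr_enorm; have := enorm_cauchy_schwarz R d u v; nra.
Qed.

(** * Summation by parts and frame variation *)

Lemma summation_by_parts (R : pzRingType) (V : lmodType R) (x : nat -> R)
    (f : nat -> V) (n : nat) :
  \sum_(i < n.+1) x i *: f i =
  (\sum_(i < n.+1) x i) *: f n +
  \sum_(i < n) (\sum_(j < i.+1) x j) *: (f i - f i.+1).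
Proof.
elim: n => [|n IH]; first by rewrite !big_ord1 big_ord0 addr0.
rewrite big_ord_recr IH [in RHS]big_ord_recr /=.
rewrite [\sum_(i < n.+1) _ *: (_ - _)]big_ord_recr /= scalerDl scalerBr.
have rearrange (a b c s : V) : a + b + c = s + c + (b + (a - s)).
  by rewrite [s + c]addrC -(addrA c) (addrC s) (addrA b) subrK addrC (addrC b).
exact: rearrange.
Qed.

(** The boundary term carries the unit vector [f n] and yields the summand 1; the triangle
    inequality handles the differences. *)
Lemma enorm_summation_by_parts (R : realType) (d : nat) (x : nat -> R)
    (f : nat -> 'rV[R]_d) (n : nat) (M : R) :
  enorm (f n) = 1 ->
  (forall k, (k <= n)%N -> `|\sum_(j < k.+1) x j| <= M) ->
  enorm (\sum_(i < n.+1) x i *: f i) <=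
  M * (\sum_(i < n) enorm (f i - f i.+1) + 1).
Proof.
move=> fn1 xM; rewrite summation_by_parts addrC mulrDr mulr1.
apply: le_trans (enormD _ _ _ _) _; apply: lerD; last first.
  by rewrite enormZ fn1 mulr1 xM.
rewrite mulr_sumr.
elim/big_ind2: _ => [|u a v b ua vb|i _]; first by rewrite enorm0.
  by apply: le_trans (enormD _ _ _ _) _; exact: lerD.
by rewrite enormZ ler_wpM2r ?enorm_ge0// xM // ltnW.
Qed.

(** The seed of the minimum is itself a path length, so every intermediate minimum is one too. *)
Lemma frame_variation_attained (R : realType) (d N : nat)
    (e : 'I_N -> 'rV[R]_d) :
  exists p : {perm 'I_N}, frame_variation e = path_length e p.
Proof.
rewrite /frame_variation.
elim/big_ind: _ => [|x y [p ->] [q ->]|p _]; [by exists 1%g | | by exists p].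
by rewrite minEle; case: ifP => _; [exists p | exists q].
Qed.

(** Puts the length in the form that summation by parts produces. The index n has no successor and
    drops out; for i < n, [insubd] never falls back to its default. *)
Lemma path_length_inord (R : realType) (d n : nat)
    (e : 'I_n.+1 -> 'rV[R]_d) (p : {perm 'I_n.+1}) :
  path_length e p =
  \sum_(i < n) enorm (e (p (inord i)) - e (p (inord i.+1))).
Proof.
rewrite /path_length big_mkcond big_ord_recr /= ltnn addr0.
apply: eq_bigr => i _; rewrite /= ltnS ltn_ord.
have -> : widen_ord (leqnSn n) i = inord i.
  by apply: val_inj; rewrite /= inordK // ltnW // ltnS.
congr enorm; congr (_ - e (p _)); apply: val_inj.
rewrite /= val_insubd ltnS ltn_ord !inordK ?ltnS ?ltn_ord //.
Qed.

Lemma measurable_enorm (R : realType) (d : nat) (dT : measure_display)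
    (T : measurableType dT) (v : T -> 'rV[R]_d) :
  (forall i, measurable_fun setT (fun w => v w 0 i)) ->
  measurable_fun setT (fun w => enorm (v w)).
Proof.
move=> mv; rewrite /enorm.
apply: (@measurableT_comp _ _ _ _ _ _ (@Num.sqrt R)).
  by apply: continuous_measurable_fun; exact: sqrt_continuous.
by apply: measurable_sum => i; apply: measurable_funX.
Qed.

(** * Probabilistic error bound *)

Theorem theorem3p1 (R : realType) (d N : nat) (e : 'I_N -> 'rV[R]_d)
    (dT : measure_display) (T : measurableType dT) (P : probability T R)
    (eta : 'I_N -> {RV P >-> R}) (delta : R) :
  unit_norm_tight_frame e ->
  0 < delta ->
  mutually_independent eta ->
  (forall j, uniform_on_Ico (eta j) (- (delta / 2)) (delta / 2)) ->
  forall eps : R, 0 < eps < 2^-1 ->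
  let Err := fun w : T => (d%:R / N%:R) *: \sum_(j < N) (eta j w) *: e j in
  ((1 - 2 * N%:R * expR (- 2 * N%:R `^ (2 * eps)))%:E <=
   P [set w | (enorm (Err w) <=
        d%:R * delta / (N%:R `^ (2^-1 - eps)) * (frame_variation e + 1))%R])%E.
Proof.
move=> [e1 _] delta0 indeta unifeta eps /andP[eps0 eps2].
(* For N = 0 the error is 0. As eps < 1/2, the power of 0 is 0, with inverse 0, so the bound reads 0
   <= 0 and the event is the whole space. *)
case: N e eta e1 indeta unifeta => [|n] e eta e1 indeta unifeta; cbv zeta.
  rewrite (_ : [set w | _] = setT).
    by rewrite probability_setT lee_fin mulr0 mul0r subr0.
  apply/seteqP; split => // w _ /=.
  by rewrite big_ord0 scaler0 enorm0 powR0 ?invr0 ?mulr0 ?mul0r// gt_eqF// subr_gt0.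
pose Err (w : T) := (d%:R / n.+1%:R) *: \sum_(j < n.+1) eta j w *: e j.
have [p sigmap] := frame_variation_attained R d n.+1 e.
set N : R := n.+1%:R.
have N0 : 0 < N by rewrite ltr0n.
(* This is delta N^(1/2+eps), with a factor N split off to cancel the 1/N in the error. *)
pose t := delta * (N * N `^ (eps - 2^-1)).
have Npow : N `^ (eps - 2^-1) = (N `^ (2^-1 - eps))^-1.
  by rewrite -powRN opprB.
have t0 : 0 < t by rewrite !mulr_gt0// powR_gt0.
pose x (w : T) (k : nat) := eta (p (inord k)) w.
(* The 0/1 weight selects the first k+1 vectors in the order [p], so a reordered partial sum becomes
   a weighted sum over the original indices, where independence is stated. *)
pose a (k : nat) (j : 'I_n.+1) : R := ((p^-1)%g j <= k)%N%:R.
have partialE (k : nat) w : (k <= n)%N ->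
    \sum_(i < k.+1) x w i = \sum_j a k j * eta j w.
  move=> kn; rewrite [RHS](reindex_perm p) /= (big_ord_widen n.+1 (x w))//.
  rewrite big_mkcond; apply: eq_bigr => i _ /=.
  rewrite /a permK /x inord_val ltnS.
  by case: ifP; rewrite ?mul1r ?mul0r.
pose B (k : nat) := [set w | t <= `|\sum_j a k j * eta j w|].
have mB k : measurable (B k).
  have mZ : measurable_fun setT (fun w => `|\sum_j a k j * eta j w|).
    apply: measurableT_comp => //.
    by apply: measurable_sum => j; exact: measurable_funM.
  rewrite (_ : B k = (fun w => `|\sum_j a k j * eta j w|) @^-1` `[t, +oo[).
    by rewrite -[_ @^-1` _]setTI; exact: mZ.
  by apply/seteqP; split => w /=; rewrite in_itv /= andbT.
have PB k : (P (B k) <= (2 * expR (- 2 * N `^ (2 * eps)))%:E)%E.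
  (* Hoeffding's exponent for c = delta/2 and V = N; 0/1 weights have at most N as sum of
     squares. *)
  have -> : - 2 * N `^ (2 * eps) = - (t ^+ 2 / (2 * (delta / 2) ^+ 2 * N)).
    have -> : N `^ (2 * eps) = N * N `^ (eps - 2^-1) ^+ 2.
      rewrite -powR_mulrn ?powR_ge0// -powRrM -{2}(powRr1 (ltW N0)) -powRD.
        by congr (_ `^ _); field.
      by rewrite (gt_eqF N0) implybT.
    by rewrite /t; field; rewrite !gt_eqF.
  apply: hoeffding_weighted_sum_norm => //; first by rewrite divr_gt0.
  rewrite -[leRHS]mulr1 /N -[n.+1 in leRHS]card_ord mulr_natl -sumr_const.
  apply: ler_sum => j _; rewrite /a; case: leqP => _.
    by rewrite expr1n.
  by rewrite expr0n ler01.
pose b := d%:R * delta / N `^ (2^-1 - eps) * (frame_variation e + 1).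
have mErr : measurable [set w | enorm (Err w) <= b].
  have mE : measurable_fun setT (fun w => enorm (Err w)).
    apply: measurable_enorm => i.
    under eq_fun do rewrite mxE summxE; apply: measurable_funM => //.
    by apply: measurable_sum => j; under eq_fun do rewrite mxE; exact: measurable_funM.
  rewrite (_ : [set w | _] = (fun w => enorm (Err w)) @^-1` `]-oo, b]).
    by rewrite -[_ @^-1` _]setTI; exact: mE.
  by apply/seteqP; split => w /=; rewrite in_itv.
(* Outside all the [B k] every partial sum is at most [t], and (d/N) t (sigma(F) + 1) is exactly
   [b]. *)
have good : ~` (\big[setU/set0]_(k < n.+1) B k) `<=` [set w | enorm (Err w) <= b].
  move=> w /= notB.
  have small (k : nat) : (k <= n)%N -> `|\sum_(j < k.+1) x w j| <= t.
    move=> kn; rewrite leNgt; apply/negP => tk; apply: notB.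
    by apply: (@bigsetU_sup _ k); rewrite // /B /= -partialE// ltW.
  have sumE : \sum_j eta j w *: e j = \sum_(i < n.+1) x w i *: e (p (inord i)).
    by rewrite (reindex_perm p); apply: eq_bigr => i _; rewrite /x inord_val.
  rewrite /Err sumE enormZ ger0_norm ?divr_ge0//.
  have := enorm_summation_by_parts R d (x w) (fun i => e (p (inord i))) n t
    (e1 _) small.
  rewrite -path_length_inord -sigmap => /(ler_wpM2l _) h.
  apply: le_trans (h (d%:R / N) _) _; first by rewrite divr_ge0.
  rewrite le_eqVlt; apply/orP; left; apply/eqP.
  by rewrite /b /t Npow; field; rewrite !gt_eqF ?powR_gt0.
apply: le_trans (le_measure P _ _ good); rewrite ?inE//; last first.
  by apply: measurableC; exact: bigsetU_measurable.
rewrite [X in (_ <= X)%E](probability_setC P); last exact: bigsetU_measurable.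
rewrite EFinB leeB//.
(* There are n+1 = N events [B k], whence the factor 2N. *)
apply: le_trans (Boole_inequality _ _) _; first by move=> k _; exact: mB.
apply: (@le_trans _ _
    (\sum_(k < n.+1) (2 * expR (- 2 * N `^ (2 * eps)))%:E)%E).
  by apply: lee_sum => k _; exact: PB.
rewrite sumEFin lee_fin sumr_const card_ord.
by rewrite -[leLHS]mulr_natl mulrA (mulrC _ 2).
Qed.
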